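(* For every integer $n\geq 90$, the $n$-cube $Q_n$ has five pairwise edge-disjoint symmetric chain decompositions.
   Context: The $n$-cube $Q_n$ is the poset of all subsets of $[n]=\{1,\dots,n\}$ ordered by inclusion, with width $a_n=\binom{n}{\lfloor n/2\rfloor}$. A symmetric chain decomposition (SCD) of $Q_n$ is a partition of $Q_n$ into $a_n$ chains each of which is symmetric (its minimal and maximal elements have sizes $k$ and $n-k$ for some $k$) and saturated (it contains a set of every size between these). An edge of $Q_n$ is a cover relation $x\subseteq y$ with $|y|=|x|+1$; a chain uses an edge $(x,y)$ if it contains both $x$ and $y$. Two SCDs are edge-disjoint if no edge is used by a chain of both decompositions. *)

(* Defs.v *)
(* MathComp world. *)
From mathcomp Require Import all_boot.

Set Implicit Arguments.
Unset Strict Implicit.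
Unset Printing Implicit Defensive.

(* The ground set [n] is rendered as 'I_n, so the elements of Q_n are the terms
   of type {set 'I_n}, ordered by \subset. *)
Notation cube n := {set 'I_n}.

Section Cube.

Variable n : nat.
Implicit Types (x y z : cube n) (C : {set cube n}) (D : {set {set cube n}}).

Definition is_chain C : Prop :=
  {in C &, forall x y, (x \subset y) || (y \subset x)}.

Definition is_minimum C x : Prop := x \in C /\ {in C, forall z, x \subset z}.

Definition is_maximum C x : Prop := x \in C /\ {in C, forall z, z \subset x}.

(* The subtraction is never truncated, since k = #|x| <= n. *)
Definition is_symmetric C : Prop :=
  exists k x y,
    [/\ is_minimum C x, is_maximum C y, #|x| = k & #|y| = n - k].

(* A nonempty finite chain has a unique minimum and a unique maximum, so for
   such C the quantification over x and y ranges over exactly one pair. *)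
Definition is_saturated C : Prop :=
  forall x y, is_minimum C x -> is_maximum C y ->
  forall m, #|x| <= m <= #|y| -> exists2 z, z \in C & #|z| = m.

Definition is_SCD D : Prop :=
  [/\ partition D [set: cube n],
      #|D| = 'C(n, n./2)
    & forall C, C \in D -> [/\ is_chain C, is_symmetric C & is_saturated C]].

Definition is_edge x y : Prop := x \subset y /\ #|y| = #|x|.+1.

Definition uses_edge C x y : Prop := [/\ is_edge x y, x \in C & y \in C].

Definition edge_disjoint D1 D2 : Prop :=
  forall x y C1 C2, C1 \in D1 -> C2 \in D2 ->
    ~ (uses_edge C1 x y /\ uses_edge C2 x y).

End Cube.

(* Main.v *)
(** Given symmetric chain decompositions of [Q_m] and [Q_n], the product
    [C1 x C2] of a chain of each is a grid in [Q_(m+n)], which splits into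
    hook-shaped symmetric chains.  An edge of [Q_(m+n)] moves in only one of the
    two factors, so edge-disjointness of the factors carries over to the
    products.  It thus suffices to find five edge-disjoint decompositions of
    [Q_10] and of [Q_11], because every [n >= 90] is of the form
    [10 * a + 11 * b].  Those two families come from a computer search among
    decompositions that are, up to the chain through the empty and the full set,
    invariant under the cyclic group of order 5 acting on two blocks of five
    points, respectively of order 11 acting on eleven points. *)

Require Import Defs.
From mathcomp Require Import all_boot.

Set Implicit Arguments.
Unset Strict Implicit.
Unset Printing Implicit Defensive.

Lemma all2_nthP (T : Type) (r : rel T) x0 s t : size s = size t ->
  reflect (forall i, i < size s -> r (nth x0 s i) (nth x0 t i)) (all2 r s t).
Proof.
elim: s t => [|x s IHs] [|y t] //= => [_|[eq_st]]; first by left.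
apply: (iffP andP) => [[rxy /(IHs _ eq_st) rst] [|i] //|rst].
  exact: rst.
by split; [exact: (rst 0) | apply/(IHs _ eq_st) => i; exact: (rst i.+1)].
Qed.

(** * Chains of bit vectors *)

Definition weight (b : bitseq) : nat := count id b.

(** [all2] fails on vectors of different lengths, so a cover also carries the equality of sizes. *)
Definition covers (b c : bitseq) : bool :=
  all2 implb b c && (weight c == (weight b).+1).

(** The equality case serves to locate an edge of a product: a half that gains no weight does not
    move. *)
Lemma leqif_weight b c :
  all2 implb b c -> weight b <= weight c ?= iff (b == c).
Proof.
rewrite /weight; elim: b c => [|a b IHb] [|d c] //=.
case: a d => [] [] //= /IHb => [H | [H _] | //].
  by rewrite -(mono_leqif (leq_add2l 1)) in H.
by split; [rewrite add0n add1n leqW | rewrite add0n add1n ltn_eqF].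
Qed.

Lemma all2_cat (T : Type) (r : rel T) s1 s2 t1 t2 : size s1 = size t1 ->
  all2 r (s1 ++ s2) (t1 ++ t2) = all2 r s1 t1 && all2 r s2 t2.
Proof. by elim: s1 t1 => [|x s IHs] [|y t] //= [] /IHs ->; rewrite andbA. Qed.

Lemma all2_implb_refl b : all2 implb b b.
Proof. by elim: b => //= -[]. Qed.

Lemma weight_cat b c : weight (b ++ c) = weight b + weight c.
Proof. exact: count_cat. Qed.

Lemma covers_catl a b c : covers (a ++ b) (a ++ c) = covers b c.
Proof.
by rewrite /covers all2_cat // all2_implb_refl !weight_cat -addnS eqn_add2l.
Qed.

Lemma covers_catr a b c : size a = size b ->
  covers (a ++ c) (b ++ c) = covers a b.
Proof.
move=> eq_ab; rewrite /covers all2_cat // all2_implb_refl andbT !weight_cat.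
by rewrite -addSn eqn_add2r.
Qed.

Lemma covers_size b c : covers b c -> size b = size c.
Proof. by rewrite /covers all2E => /andP[/andP[/eqP]]. Qed.

Lemma covers_weight b c : covers b c -> weight c = (weight b).+1.
Proof. by case/andP => _ /eqP. Qed.

(** Neither half can lose weight and the total gain is one, so one half gains exactly one and the
    other, gaining nothing, is unchanged. *)
Lemma covers_catP b1 b2 c1 c2 : size b1 = size c1 ->
    covers (b1 ++ b2) (c1 ++ c2) ->
  (b1 = c1 /\ covers b2 c2) \/ (covers b1 c1 /\ b2 = c2).
Proof.
move=> eq_sz; rewrite {1}/covers all2_cat // !weight_cat.
case/andP=> /andP[sub1 sub2] /eqP wE.
have [le1 eq1] := leqif_weight sub1; have [le2 eq2] := leqif_weight sub2.
move: le1; rewrite leq_eqVlt eq1 => /predU1P[bc1|lt1].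
  left; subst c1; rewrite /covers sub2; split=> //.
  by apply/eqP/(@addnI (weight b1)); rewrite wE addnS.
right; have wc1 : weight c1 = (weight b1).+1.
  apply/eqP; rewrite eqn_leq lt1 andbT -(leq_add2r (weight b2)) addSn -wE.
  by rewrite leq_add2l.
split; first by rewrite /covers sub1 wc1 eqxx.
by apply/eqP; rewrite -eq2; move: wE; rewrite wc1 addSn => -[] /addnI ->.
Qed.

(** Saturation is built in through consecutive covers. The length of the vectors is fixed elsewhere,
    by [bit_SCD_mem]. *)
Definition sym_chain (n : nat) (C : seq bitseq) : bool :=
  if C is b :: C' then
    path covers b C' && (weight b + weight (last b C') == n)
  else false.

Record bit_SCD (n : nat) (D : seq (seq bitseq)) : Prop := BitSCD {
  bit_SCD_chain : all (sym_chain n) D;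
  bit_SCD_uniq : uniq (flatten D);
  bit_SCD_mem : flatten D =i [pred b | size b == n] }.

Definition bit_edge_disjoint (D1 D2 : seq (seq bitseq)) : Prop :=
  forall b c C1 C2, C1 \in D1 -> C2 \in D2 -> covers b c ->
  ~ [/\ b \in C1, c \in C1, b \in C2 & c \in C2].

(** Indexing by ['I_k] allows products to be taken index by index. *)
Definition edge_disjoint_SCDs (k n : nat) : Prop :=
  exists2 D : 'I_k -> seq (seq bitseq), forall i, bit_SCD n (D i) &
    forall i j, i != j -> bit_edge_disjoint (D i) (D j).

(** * Products *)

(** The classical de Bruijn-Tengbergen-Kruyswijk peeling of a grid. The outer hook climbs [D] over
    the bottom of [C], then climbs [C] beside the top of [D]; what remains is the grid without the
    bottom of [C] and the top of [D]. *)
Fixpoint hooks (C D : seq bitseq) : seq (seq bitseq) :=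
  match C, D with
  | b :: C', d :: D' =>
    (map (cat b) D ++ map (cat^~ (last d D')) C') :: hooks C' (belast d D')
  | _, _ => [::]
  end.

Lemma hooks_rcons b C D d : hooks (b :: C) (rcons D d) =
  (map (cat b) (rcons D d) ++ map (cat^~ d) C) :: hooks C D.
Proof. by case: D => [|e D] //=; rewrite last_rcons belast_rcons. Qed.

(** Each peeling removes one row and one column of the grid, so every cell falls in exactly one
    hook. *)
Lemma perm_hooks C D :
  perm_eq (flatten (hooks C D)) [seq b ++ d | b <- C, d <- D].
Proof.
elim: C D => [|b C IHC] D //; case/lastP: D => [|D d].
  by rewrite allpairs0r.
rewrite hooks_rcons /= -catA perm_cat2l perm_sym.
rewrite (allpairs_rconsr _ _ (fun=> d) (fun=> D)) perm_catC.
by rewrite perm_cat2l perm_sym.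
Qed.

Lemma path_covers_catl a b C :
  path covers (a ++ b) (map (cat a) C) = path covers b C.
Proof. exact/mono_path/covers_catl. Qed.

(** An implication only: cancelling a common suffix asks for equal lengths, and these are read off
    from the given covers. *)
Lemma path_covers_catr a b C :
  path covers b C -> path covers (b ++ a) (map (cat^~ a) C).
Proof.
apply: (homo_path (f := cat^~ a)) => x y cov.
by rewrite covers_catr ?(covers_size cov).
Qed.

Lemma last_map_catr (a b : bitseq) C :
  last (b ++ a) [seq c ++ a | c <- C] = last b C ++ a.
Proof. exact: (last_map (cat^~ a)). Qed.

(** The sum [n] is an invariant of the peeling: the new bottom of the first chain is heavier by one,
    the new top of the second is lighter by one. *)
Lemma hooks_sym_chain n b C d D :
    path covers b C -> path covers d D ->
    weight b + weight (last b C) + (weight d + weight (last d D)) = n ->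
  all (sym_chain n) (hooks (b :: C) (d :: D)).
Proof.
elim: C b d D => [|b' C IHC] b d D.
  rewrite /= cats0 path_covers_catl => _ -> <-.
  by rewrite last_map !weight_cat addnACA eqxx.
(* If the second chain is a single point, the only hook is a translate of the first chain. Otherwise
   [e] is the top at which the hook turns. *)
move=> chC; have /andP[cov_b chC'] := chC; case/lastP: D => [|D e].
  move=> _ <-; rewrite /= path_covers_catr // last_map_catr !weight_cat.
  by rewrite covers_catr ?(covers_size cov_b) // cov_b addnACA eqxx.
rewrite rcons_path last_rcons -rcons_cons => /andP[chD cov_e] wE.
rewrite hooks_rcons; apply/andP; split; last first.
  apply: IHC => //; rewrite -wE (covers_weight cov_e) /= (covers_weight cov_b).
  by rewrite addSn !addnS.
rewrite [sym_chain _ _]/= cat_path last_cat -/(map _ (b' :: C)).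
rewrite path_covers_catl rcons_path chD cov_e last_map last_rcons.
by rewrite path_covers_catr //= last_map_catr !weight_cat addnACA wE eqxx.
Qed.

Definition prod_SCD (D1 D2 : seq (seq bitseq)) : seq (seq bitseq) :=
  flatten [seq hooks C1 C2 | C1 <- D1, C2 <- D2].

Lemma perm_prod_SCD D1 D2 :
  perm_eq (flatten (prod_SCD D1 D2))
          [seq b ++ c | b <- flatten D1, c <- flatten D2].
Proof.
elim: D1 => //= C1 D1 IHD1; rewrite /prod_SCD /= !flatten_cat allpairs_cat.
apply: perm_cat => {D1 IHD1} //; elim: D2 => [|C2 D2 IHD2].
  by rewrite allpairs0r.
rewrite /= flatten_cat perm_sym (perm_allpairs_catr _ _ (fun=> C2)) perm_sym.
by apply: perm_cat => //; apply: perm_hooks.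
Qed.

Lemma bit_SCD_size n D C b : bit_SCD n D -> C \in D -> b \in C -> size b = n.
Proof.
move=> scdD DC Cb; apply/eqP; rewrite -[_ == _]/(b \in [pred b | size b == n]).
by rewrite -(bit_SCD_mem scdD); apply/flattenP; exists C.
Qed.

(** A vector of length [m + n] splits in one way after [m] bits, so the concatenations list every
    vector exactly once. *)
Lemma prod_bit_SCD m n D1 D2 :
  bit_SCD m D1 -> bit_SCD n D2 -> bit_SCD (m + n) (prod_SCD D1 D2).
Proof.
move=> [ch1 uniq1 mem1] [ch2 uniq2 mem2]; split.
- apply/allP => C /flattenP[_ /allpairsP[[C1 C2] /= [D1C1 D2C2 ->]]].
  apply: allP C; move/(allP ch1): D1C1; move/(allP ch2): D2C2.
  case: C1 C2 => [|b C1] [|c C2] //= /andP[ch_c /eqP w2] /andP[ch_b /eqP w1].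
  by apply: hooks_sym_chain; rewrite // w1 w2.
- rewrite (perm_uniq (perm_prod_SCD D1 D2)); apply: allpairs_uniq => //.
  move=> x y /allpairsP[[b1 c1] /= [D1b1 _ ->]].
  move=> /allpairsP[[b2 c2] /= [D1b2 _ ->]].
  move=> /eqP; rewrite eqseq_cat; first by case/andP=> /eqP-> /eqP->.
  by move: D1b1 D1b2; rewrite !mem1 !inE => /eqP-> /eqP->.
move=> b; rewrite (perm_mem (perm_prod_SCD D1 D2)) inE.
apply/allpairsP/eqP => [[[b1 b2] /= []]|sz_b].
  by rewrite mem1 mem2 !inE => /eqP <- /eqP <- ->; rewrite size_cat.
exists (take m b, drop m b); rewrite /= cat_take_drop mem1 mem2 !inE.
by rewrite size_drop size_takel ?sz_b ?leq_addr // addKn !eqxx.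
Qed.

(** The ends of a common edge have the same halves in both products. The half that moves is then an
    edge common to two decompositions of one factor. *)
Lemma prod_bit_edge_disjoint m n D1 D2 D1' D2' :
    bit_SCD m D1 -> bit_SCD n D2 -> bit_SCD m D1' -> bit_SCD n D2' ->
    bit_edge_disjoint D1 D1' -> bit_edge_disjoint D2 D2' ->
  bit_edge_disjoint (prod_SCD D1 D2) (prod_SCD D1' D2').
Proof.
move=> S1 S2 S1' S2' dis1 dis2 b c C E.
move=> /flattenP[_ /allpairsP[[C1 C2] /= [D1C1 D2C2 ->]] hC].
move=> /flattenP[_ /allpairsP[[E1 E2] /= [D1E1 D2E2 ->]] hE] cov.
move=> [Cb Cc Eb Ec].
(* A member of a hook has its halves in the two chains that span the grid. *)
have grid X1 X2 X y : X \in hooks X1 X2 -> y \in X ->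
    exists2 p, p.1 \in X1 /\ p.2 \in X2 & y = p.1 ++ p.2.
  move=> hX Xy; have /allpairsP[p [*]] : y \in [seq u ++ v | u <- X1, v <- X2].
    by rewrite -(perm_mem (perm_hooks X1 X2)); apply/flattenP; exists X.
  by exists p.
have [[b1 b2] /= [Cb1 Cb2] Db] := grid _ _ _ _ hC Cb.
have [[c1 c2] /= [Cc1 Cc2] Dc] := grid _ _ _ _ hC Cc.
have [[b1' b2'] /= [Eb1 Eb2] Db'] := grid _ _ _ _ hE Eb.
have [[c1' c2'] /= [Ec1 Ec2] Dc'] := grid _ _ _ _ hE Ec.
have sb1 := bit_SCD_size S1 D1C1 Cb1; have sc1 := bit_SCD_size S1 D1C1 Cc1.
have sb1' := bit_SCD_size S1' D1E1 Eb1; have sc1' := bit_SCD_size S1' D1E1 Ec1.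
move: Db'; rewrite Db => /eqP; rewrite eqseq_cat ?sb1 //.
move=> /andP[/eqP eb1 /eqP eb2].
move: Dc'; rewrite Dc => /eqP; rewrite eqseq_cat ?sc1 //.
move=> /andP[/eqP ec1 /eqP ec2].
rewrite Db Dc in cov; case: (covers_catP _ cov) => [|[_ cov2]|[cov1 _]].
- by rewrite sb1 sc1.
- by apply: (dis2 b2 c2 C2 E2) => //; rewrite eb2 ec2 in Cb2 Cc2 *.
by apply: (dis1 b1 c1 C1 E1) => //; rewrite eb1 ec1 in Cb1 Cc1 *.
Qed.

Lemma edge_disjoint_SCDs_add k m n :
  edge_disjoint_SCDs k m -> edge_disjoint_SCDs k n ->
  edge_disjoint_SCDs k (m + n).
Proof.
move=> [D1 S1 dis1] [D2 S2 dis2]; exists (fun i => prod_SCD (D1 i) (D2 i)).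
  by move=> i; apply: prod_bit_SCD.
by move=> i j nij; apply: prod_bit_edge_disjoint (dis1 i j nij) (dis2 i j nij).
Qed.

(** [Q_0] has one point and no edge, so [k] copies of its only decomposition are edge-disjoint. This
    starts the induction on multiples. *)
Lemma edge_disjoint_SCDs0 k : edge_disjoint_SCDs k 0.
Proof.
exists (fun=> [:: [:: [::]]]) => [i|i j _ b c C1 C2]; first by split=> // -[].
rewrite !inE => /eqP-> _ + [] => /[swap].
by rewrite !inE => /eqP-> /[swap] /eqP->.
Qed.

Lemma edge_disjoint_SCDs_muln k n a :
  edge_disjoint_SCDs k n -> edge_disjoint_SCDs k (a * n).
Proof.
move=> kn; elim: a => [|a IHa]; first exact: edge_disjoint_SCDs0.
by rewrite mulSn; apply: edge_disjoint_SCDs_add.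
Qed.

(** * Dimensions 10 and 11 *)

(** The default [~~ a] discards empty vectors. *)
Definition behead_with (a : bool) (s : seq bitseq) : seq bitseq :=
  [seq behead b | b <- s & nth (~~ a) b 0 == a].

(** A radix partition by leading bits. An empty bucket settles all vectors below it by the single
    test [P 0], which keeps vectors of length 22 within reach of computation. *)
Fixpoint all_counts (P : pred nat) (n : nat) (s : seq bitseq) : bool :=
  match n, s with
  | _, [::] => P 0
  | 0, _ => P (size s)
  | n'.+1, _ => all_counts P n' (behead_with true s) &&
                all_counts P n' (behead_with false s)
  end.

Lemma count_behead_with a b s :
  count_mem b (behead_with a s) = count_mem (a :: b) s.
Proof.
rewrite /behead_with count_map count_filter; apply: eq_count => -[|a' b'] /=.
  by case: a; rewrite andbF.
by rewrite eqseq_cons andbC.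
Qed.

Lemma all_countsP P n s b : all (fun b => size b == n) s -> all_counts P n s ->
  size b = n -> P (count_mem b s).
Proof.
elim: n s b => [|n IHn] [|c s] b // sz_s; rewrite /all_counts -/all_counts.
  move=> Ps /size0nil->.
  (* After all bits are consumed, every vector left in the bucket is empty, so the size of the
     bucket is the multiplicity. *)
  suff /eqP-> : count_mem [::] (c :: s) == size (c :: s) by [].
  by rewrite -all_count; apply: sub_all sz_s => -[].
case/andP=> Pt Pf; case: b => // a b [sz_b]; rewrite -count_behead_with.
apply: IHn => //; last by case: a.
rewrite /behead_with all_map all_filter; apply: sub_all sz_s => -[|a' b'] //=.
by rewrite eqSS => ->; rewrite implybT.
Qed.

(** An edge is coded by the concatenation of its ends, so that [all_counts] applies to edges as it
    does to vertices. *)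
Definition chain_edges (C : seq bitseq) : seq bitseq :=
  [seq p.1 ++ p.2 | p <- [seq (b, c) | b <- C, c <- C] & covers p.1 p.2].

(** The edges of all decompositions are pooled, and multiplicity at most one settles all pairs in
    one traversal. *)
Definition check_SCDs (n : nat) (Ds : seq (seq (seq bitseq))) : bool :=
  all (fun D => [&& all (sym_chain n) D, all (fun b => size b == n) (flatten D)
                  & all_counts (pred1 1) n (flatten D)]) Ds &&
  all_counts (fun k => k <= 1) (n + n)
    (flatten [seq flatten (map chain_edges D) | D <- Ds]).

Lemma count_flatten_gt1 (T : Type) (a : pred T) (ss : seq (seq T))
    (i j : 'I_(size ss)) : i != j ->
  has a (nth [::] ss i) -> has a (nth [::] ss j) -> 1 < count a (flatten ss).
Proof.
rewrite !has_count => nij ci cj.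
rewrite count_flatten sumnE big_map (big_nth [::]) big_mkord (bigD1 i) //=.
rewrite (bigD1 j) 1?eq_sym //= addnA -addn1.
by apply: leq_trans (leq_addr _ _); apply: leq_add.
Qed.

Lemma mem_chain_edges C b c :
  b \in C -> c \in C -> covers b c -> b ++ c \in chain_edges C.
Proof.
move=> Cb Cc cov; apply/mapP; exists (b, c) => //.
by rewrite mem_filter cov; apply: allpairs_f.
Qed.

Lemma check_SCDsP n Ds : check_SCDs n Ds -> edge_disjoint_SCDs (size Ds) n.
Proof.
case/andP=> /allP ok dis; exists (fun i => nth [::] Ds i) => [i|i j nij].
  have /ok/and3P[ch sz cnt] := mem_nth [::] (ltn_ord i).
  (* Multiplicity one yields both coverage of the cube and absence of repetitions. *)
  have cnt1 b : size b = n -> count_mem b (flatten (nth [::] Ds i)) = 1.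
    by move=> sz_b; apply/eqP; apply: all_countsP cnt sz_b.
  have mem_i : flatten (nth [::] Ds i) =i [pred b | size b == n].
    move=> b; rewrite inE; apply/idP/eqP => [/(allP sz)/eqP // | /cnt1 cb].
    by rewrite -has_pred1 has_count cb.
  split=> //; apply/count_mem_uniq => b; case: (boolP (b \in _)) => [|nb].
    by rewrite mem_i => /eqP/cnt1.
  by apply/count_memPn.
move=> b c C1 C2 iC1 jC2 cov [bC1 cC1 bC2 cC2].
have sz D C x : D \in Ds -> C \in D -> x \in C -> size x = n.
  by move=> /ok/and3P[_ /allP szD _] DC Cx; apply/eqP/szD/flattenP; exists C.
have mem_edges (D : seq (seq bitseq)) C : C \in D -> b \in C -> c \in C ->
    b ++ c \in flatten (map chain_edges D).
  move=> DC bC cC; apply/flatten_mapP; exists C => //.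
  exact: mem_chain_edges.
(* An edge shared by the entries [i] and [j] would be counted twice in the pool. *)
have : count_mem (b ++ c)
    (flatten [seq flatten (map chain_edges D) | D <- Ds]) <= 1.
  apply: (all_countsP _ dis); last first.
    by rewrite size_cat !(sz (nth [::] Ds i) C1) ?mem_nth.
  apply/allP => z /flatten_mapP[D DsD] /flatten_mapP[C DC] /mapP[[x y]].
  rewrite mem_filter /= => /andP[_ /allpairsP[[x' y'] /= [Cx Cy [-> ->]]]] ->.
  by rewrite size_cat !(sz D C).
rewrite leqNgt => /negP; apply.
(* The indices refer to [Ds], whereas the count runs over its image under a map; hence the casts. *)
have eq_sz : size Ds = size [seq flatten (map chain_edges D) | D <- Ds].
  by rewrite size_map.
apply: (count_flatten_gt1 (i := cast_ord eq_sz i) (j := cast_ord eq_sz j)).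
- by rewrite (inj_eq (@cast_ord_inj _ _ _)).
- by rewrite has_pred1 (nth_map [::]) //=; apply: mem_edges bC1 cC1.
by rewrite has_pred1 (nth_map [::]) //=; apply: mem_edges bC2 cC2.
Qed.

(* A word [w] of length at least [n./2] stands for the symmetric chain of the
   sets of letters of its prefixes, of sizes [n - size w] up to [size w]. *)
Definition word_chain (n : nat) (w : seq nat) : seq bitseq :=
  [seq [seq i \in take m w | i <- iota 0 n]
     | m <- iota (n - size w) ((size w).*2.+1 - n)].

(* Blocks of [p] consecutive points are rotated. *)
Definition rotate (p i : nat) : nat := i %/ p * p + i.+1 %% p.

(* Truncation to [n.-1] letters keeps the empty and the full set out of all
   rotations of a chain but the chain itself. *)
Definition rotations (n p : nat) (w : seq nat) : seq (seq nat) :=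
  w :: [seq take n.-1 (map (iter r (rotate p)) w) | r <- iota 1 p.-1].

Definition rotation_SCD (n p : nat) (fixed ws : seq (seq nat)) :=
  map (word_chain n) (fixed ++ flatten (map (rotations n p) ws)).

(** Each entry has 50 words. Five rotations of each, with two fixed blocks, make 252 chains, which
    is ['C(10, 5)]. The last word, of length 10, gives the chain through the empty and the full
    set. *)
Definition words10 : seq (seq (seq nat)) := [::
  [::
    [:: 0; 1; 3; 5; 7]; [:: 0; 2; 3; 5; 6]; [:: 1; 2; 4; 5; 7];
    [:: 1; 2; 5; 6; 7]; [:: 1; 3; 4; 5; 7]; [:: 2; 4; 5; 6; 7];
    [:: 3; 4; 5; 6; 7]; [:: 3; 5; 6; 7; 8]; [:: 0; 1; 2; 3; 9; 7];
    [:: 0; 1; 2; 5; 9; 6]; [:: 0; 1; 5; 7; 9; 4]; [:: 0; 2; 3; 5; 1; 4];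
    [:: 0; 3; 5; 6; 4; 1]; [:: 0; 5; 6; 7; 4; 8]; [:: 1; 2; 4; 5; 0; 9];
    [:: 1; 2; 5; 6; 9; 4]; [:: 1; 2; 5; 7; 0; 6]; [:: 1; 3; 5; 6; 7; 4];
    [:: 1; 3; 5; 7; 9; 0]; [:: 1; 4; 5; 7; 9; 2]; [:: 1; 5; 6; 7; 0; 8];
    [:: 2; 4; 5; 7; 0; 1]; [:: 2; 5; 6; 8; 9; 1]; [:: 3; 4; 5; 7; 9; 8];
    [:: 4; 5; 6; 7; 1; 9]; [:: 5; 6; 7; 8; 1; 9]; [:: 0; 1; 2; 6; 9; 3; 4];
    [:: 0; 1; 3; 6; 4; 7; 9]; [:: 0; 1; 5; 6; 3; 9; 2];
    [:: 0; 4; 5; 3; 7; 6; 2]; [:: 0; 5; 7; 9; 4; 3; 8];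
    [:: 1; 4; 5; 3; 0; 8; 9]; [:: 1; 5; 6; 4; 3; 9; 7];
    [:: 1; 5; 7; 8; 3; 9; 6]; [:: 2; 5; 6; 9; 4; 0; 3];
    [:: 2; 5; 7; 3; 0; 8; 1]; [:: 3; 4; 5; 9; 0; 6; 8];
    [:: 4; 5; 6; 3; 8; 1; 9]; [:: 4; 5; 7; 0; 1; 8; 6];
    [:: 5; 6; 7; 2; 8; 4; 1]; [:: 5; 6; 8; 3; 9; 1; 0];
    [:: 0; 1; 8; 2; 5; 3; 6; 7]; [:: 0; 2; 9; 4; 8; 1; 3; 5];
    [:: 0; 5; 6; 8; 3; 4; 7; 9]; [:: 1; 5; 2; 3; 9; 6; 7; 4];
    [:: 4; 5; 2; 6; 0; 8; 1; 3]; [:: 5; 6; 3; 2; 8; 7; 9; 0];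
    [:: 5; 7; 3; 0; 8; 4; 1; 6]; [:: 5; 3; 0; 8; 9; 7; 1; 4; 6];
    [:: 0; 8; 3; 9; 4; 2; 5; 6; 1; 7]];
  [::
    [:: 0; 1; 4; 5; 6]; [:: 0; 2; 3; 4; 5]; [:: 0; 3; 5; 6; 8];
    [:: 0; 4; 5; 6; 8]; [:: 0; 5; 6; 7; 8]; [:: 1; 4; 5; 6; 7];
    [:: 2; 3; 4; 5; 6]; [:: 2; 4; 5; 6; 7]; [:: 0; 1; 2; 3; 7; 6];
    [:: 0; 1; 2; 5; 8; 9]; [:: 0; 1; 3; 5; 2; 6]; [:: 0; 1; 4; 5; 2; 3];
    [:: 0; 1; 5; 6; 2; 7]; [:: 0; 2; 5; 7; 9; 8]; [:: 0; 3; 4; 5; 8; 2];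
    [:: 0; 3; 5; 7; 4; 1]; [:: 0; 4; 5; 6; 7; 1]; [:: 1; 2; 4; 5; 3; 6];
    [:: 1; 2; 5; 7; 6; 4]; [:: 1; 5; 6; 8; 7; 4]; [:: 2; 3; 4; 5; 9; 7];
    [:: 2; 3; 5; 7; 8; 0]; [:: 3; 4; 5; 6; 1; 8]; [:: 3; 5; 6; 7; 2; 8];
    [:: 3; 5; 6; 8; 7; 1]; [:: 4; 5; 6; 7; 8; 0]; [:: 0; 1; 2; 9; 6; 8; 4];
    [:: 0; 1; 3; 7; 5; 2; 4]; [:: 0; 1; 5; 7; 4; 9; 6];
    [:: 0; 2; 5; 9; 1; 7; 4]; [:: 0; 3; 5; 2; 7; 4; 6];
    [:: 0; 5; 6; 2; 4; 9; 7]; [:: 1; 4; 5; 6; 2; 9; 8];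
    [:: 1; 5; 6; 7; 3; 2; 0]; [:: 1; 5; 7; 4; 3; 6; 2];
    [:: 2; 3; 5; 8; 0; 9; 4]; [:: 2; 5; 6; 1; 8; 4; 7];
    [:: 3; 5; 6; 0; 7; 4; 9]; [:: 3; 5; 7; 9; 2; 8; 6];
    [:: 4; 5; 7; 9; 1; 3; 6]; [:: 5; 6; 8; 2; 3; 0; 4];
    [:: 0; 1; 6; 3; 5; 4; 7; 2]; [:: 0; 2; 8; 5; 4; 1; 6; 7];
    [:: 1; 5; 3; 7; 8; 2; 0; 9]; [:: 3; 5; 9; 1; 7; 6; 2; 0];
    [:: 4; 5; 3; 7; 6; 8; 0; 2]; [:: 5; 6; 9; 7; 1; 8; 4; 2];
    [:: 5; 7; 0; 6; 1; 9; 2; 8]; [:: 0; 5; 8; 9; 3; 6; 1; 4; 7];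
    [:: 5; 2; 1; 9; 4; 3; 0; 7; 6; 8]];
  [::
    [:: 0; 1; 2; 5; 6]; [:: 0; 2; 3; 5; 7]; [:: 0; 2; 4; 5; 6];
    [:: 0; 3; 5; 6; 7]; [:: 0; 4; 5; 6; 8]; [:: 1; 2; 3; 5; 7];
    [:: 1; 3; 5; 6; 7]; [:: 2; 4; 5; 6; 8]; [:: 0; 1; 3; 5; 7; 8];
    [:: 0; 1; 5; 7; 2; 9]; [:: 0; 2; 4; 5; 7; 3]; [:: 0; 4; 5; 7; 9; 8];
    [:: 0; 5; 6; 7; 8; 9]; [:: 1; 2; 5; 6; 4; 7]; [:: 1; 2; 5; 7; 9; 8];
    [:: 1; 3; 4; 5; 2; 7]; [:: 1; 3; 5; 6; 0; 8]; [:: 1; 5; 6; 7; 2; 3];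
    [:: 1; 5; 6; 8; 3; 7]; [:: 2; 4; 5; 6; 7; 8]; [:: 2; 4; 5; 7; 8; 3];
    [:: 3; 4; 5; 6; 2; 0]; [:: 3; 4; 5; 7; 0; 9]; [:: 4; 5; 6; 7; 0; 2];
    [:: 4; 5; 6; 8; 9; 3]; [:: 5; 6; 7; 8; 4; 1]; [:: 0; 1; 2; 3; 6; 7; 4];
    [:: 0; 1; 3; 9; 6; 8; 5]; [:: 0; 2; 5; 3; 9; 1; 8];
    [:: 0; 5; 7; 3; 9; 1; 4]; [:: 1; 2; 5; 0; 3; 7; 8];
    [:: 1; 4; 5; 9; 6; 0; 8]; [:: 1; 5; 7; 9; 0; 8; 3];
    [:: 2; 3; 5; 7; 4; 9; 8]; [:: 2; 4; 5; 3; 0; 1; 7];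
    [:: 2; 5; 7; 0; 8; 6; 9]; [:: 3; 5; 6; 8; 4; 2; 7];
    [:: 3; 5; 7; 1; 4; 9; 2]; [:: 4; 5; 6; 1; 7; 0; 8];
    [:: 4; 5; 7; 1; 0; 2; 9]; [:: 5; 6; 7; 3; 4; 1; 9];
    [:: 0; 1; 7; 2; 8; 9; 3; 6]; [:: 0; 2; 7; 8; 4; 9; 3; 6];
    [:: 0; 5; 1; 4; 3; 7; 8; 2]; [:: 1; 5; 6; 9; 8; 3; 4; 0];
    [:: 2; 5; 6; 3; 7; 4; 9; 0]; [:: 3; 5; 1; 2; 6; 0; 9; 8];
    [:: 5; 7; 9; 4; 8; 3; 6; 0]; [:: 0; 6; 1; 7; 5; 3; 9; 8; 2];
    [:: 7; 8; 2; 3; 1; 0; 6; 4; 5; 9]];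
  [::
    [:: 0; 1; 2; 5; 7]; [:: 0; 3; 5; 6; 7]; [:: 0; 4; 5; 6; 7];
    [:: 1; 2; 3; 4; 5]; [:: 1; 2; 4; 5; 7]; [:: 1; 2; 5; 6; 8];
    [:: 1; 5; 6; 7; 8]; [:: 2; 3; 4; 5; 7]; [:: 0; 1; 5; 6; 7; 4];
    [:: 0; 2; 5; 7; 4; 9]; [:: 0; 3; 5; 7; 2; 1]; [:: 0; 5; 6; 7; 2; 3];
    [:: 1; 2; 3; 5; 8; 0]; [:: 1; 2; 5; 6; 3; 9]; [:: 1; 3; 5; 7; 0; 9];
    [:: 1; 4; 5; 6; 8; 9]; [:: 1; 4; 5; 7; 6; 8]; [:: 2; 3; 4; 5; 8; 1];
    [:: 2; 3; 5; 6; 4; 8]; [:: 2; 3; 5; 7; 6; 9]; [:: 2; 4; 5; 6; 1; 0];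
    [:: 2; 4; 5; 7; 6; 1]; [:: 2; 5; 6; 7; 1; 8]; [:: 3; 4; 5; 6; 0; 2];
    [:: 3; 4; 5; 7; 1; 2]; [:: 4; 5; 6; 7; 3; 0]; [:: 0; 1; 2; 7; 3; 4; 6];
    [:: 0; 1; 3; 2; 5; 9; 7]; [:: 0; 1; 5; 2; 6; 8; 9];
    [:: 0; 3; 5; 1; 6; 2; 8]; [:: 0; 5; 6; 4; 8; 1; 2];
    [:: 1; 3; 5; 4; 9; 6; 2]; [:: 1; 4; 5; 0; 6; 9; 3];
    [:: 1; 5; 6; 8; 9; 0; 3]; [:: 2; 4; 5; 9; 7; 6; 3];
    [:: 2; 5; 6; 0; 9; 4; 1]; [:: 3; 4; 5; 8; 6; 0; 2];
    [:: 3; 5; 6; 1; 4; 7; 0]; [:: 4; 5; 7; 8; 2; 6; 9];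
    [:: 5; 6; 7; 1; 9; 4; 0]; [:: 5; 6; 8; 7; 0; 4; 1];
    [:: 0; 2; 5; 4; 1; 7; 3; 6]; [:: 1; 5; 8; 9; 7; 6; 2; 0];
    [:: 2; 5; 3; 0; 4; 9; 7; 1]; [:: 3; 5; 8; 6; 1; 4; 7; 9];
    [:: 4; 5; 8; 0; 1; 9; 2; 6]; [:: 5; 6; 4; 8; 2; 0; 9; 3];
    [:: 5; 7; 2; 8; 3; 9; 0; 1]; [:: 5; 0; 4; 7; 8; 3; 9; 2; 1];
    [:: 1; 0; 9; 3; 8; 6; 7; 4; 5; 2]];
  [::
    [:: 0; 1; 2; 4; 5]; [:: 0; 1; 3; 5; 7]; [:: 0; 1; 4; 5; 7];
    [:: 0; 2; 5; 6; 8]; [:: 0; 3; 4; 5; 7]; [:: 0; 3; 5; 6; 8];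
    [:: 1; 3; 4; 5; 6]; [:: 2; 5; 6; 7; 8]; [:: 0; 1; 3; 5; 4; 6];
    [:: 0; 2; 3; 5; 8; 6]; [:: 0; 2; 4; 5; 6; 3]; [:: 0; 2; 5; 6; 3; 9];
    [:: 0; 2; 5; 7; 3; 6]; [:: 0; 3; 5; 6; 1; 7]; [:: 0; 3; 5; 7; 6; 8];
    [:: 0; 4; 5; 6; 3; 9]; [:: 0; 5; 6; 8; 7; 2]; [:: 1; 2; 3; 5; 0; 8];
    [:: 1; 2; 5; 7; 8; 0]; [:: 1; 4; 5; 6; 9; 3]; [:: 1; 4; 5; 7; 2; 8];
    [:: 1; 5; 6; 7; 4; 2]; [:: 2; 3; 5; 6; 1; 4]; [:: 2; 4; 5; 6; 3; 9];
    [:: 2; 5; 6; 8; 4; 9]; [:: 4; 5; 6; 8; 7; 2]; [:: 0; 1; 3; 4; 6; 9; 5];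
    [:: 0; 1; 5; 8; 7; 9; 6]; [:: 0; 2; 5; 1; 7; 3; 9];
    [:: 0; 3; 5; 4; 9; 1; 7]; [:: 0; 4; 5; 1; 9; 2; 3];
    [:: 0; 5; 6; 7; 9; 1; 3]; [:: 0; 5; 7; 4; 6; 9; 1];
    [:: 1; 2; 5; 6; 7; 9; 3]; [:: 1; 3; 5; 6; 8; 0; 9];
    [:: 1; 5; 7; 0; 6; 2; 3]; [:: 2; 5; 7; 9; 1; 3; 4];
    [:: 3; 4; 5; 1; 7; 0; 6]; [:: 3; 5; 6; 7; 1; 8; 0];
    [:: 3; 5; 7; 4; 8; 0; 6]; [:: 4; 5; 7; 2; 3; 1; 6];
    [:: 0; 2; 6; 9; 1; 7; 8; 5]; [:: 0; 5; 9; 4; 7; 1; 2; 8];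
    [:: 1; 5; 9; 6; 2; 0; 7; 3]; [:: 2; 5; 4; 1; 6; 8; 9; 3];
    [:: 3; 5; 2; 9; 6; 8; 0; 4]; [:: 4; 5; 6; 7; 2; 3; 0; 1];
    [:: 5; 6; 8; 1; 4; 3; 0; 9]; [:: 5; 8; 9; 7; 0; 6; 2; 4; 3];
    [:: 4; 0; 3; 6; 2; 1; 9; 8; 7; 5]]].

(** Each entry has 42 words, whose eleven rotations make 462 chains, which is ['C(11, 5)]. *)
Definition words11 : seq (seq (seq nat)) := [::
  [::
    [:: 0; 1; 2; 3; 5; 8]; [:: 0; 1; 2; 4; 7; 9]; [:: 0; 1; 2; 5; 6; 7];
    [:: 0; 1; 2; 5; 8; 10]; [:: 0; 1; 3; 4; 5; 6]; [:: 0; 1; 3; 5; 7; 9];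
    [:: 0; 1; 3; 5; 8; 4]; [:: 0; 1; 4; 5; 6; 2]; [:: 0; 1; 4; 5; 8; 10];
    [:: 0; 2; 3; 4; 5; 7]; [:: 0; 2; 3; 4; 6; 5]; [:: 0; 2; 4; 6; 8; 3];
    [:: 0; 1; 2; 3; 4; 5; 10]; [:: 0; 1; 2; 4; 5; 9; 6];
    [:: 0; 1; 3; 4; 8; 7; 10]; [:: 0; 1; 3; 7; 10; 4; 2];
    [:: 0; 1; 4; 6; 10; 3; 8]; [:: 0; 1; 4; 7; 6; 2; 10];
    [:: 0; 1; 5; 7; 9; 4; 10]; [:: 0; 2; 3; 4; 8; 1; 9];
    [:: 0; 2; 3; 6; 9; 5; 1]; [:: 0; 2; 4; 5; 6; 10; 8];
    [:: 0; 2; 4; 7; 5; 6; 3]; [:: 0; 2; 5; 6; 3; 10; 9];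
    [:: 0; 2; 5; 8; 6; 9; 7]; [:: 0; 3; 4; 5; 6; 9; 2];
    [:: 0; 3; 5; 7; 10; 4; 6]; [:: 0; 1; 3; 5; 6; 2; 10; 9];
    [:: 0; 1; 4; 10; 8; 6; 5; 7]; [:: 0; 1; 5; 4; 7; 6; 2; 8];
    [:: 0; 2; 3; 8; 6; 5; 1; 4]; [:: 0; 2; 5; 10; 8; 4; 7; 3];
    [:: 0; 2; 6; 8; 1; 5; 7; 3]; [:: 0; 3; 6; 7; 1; 9; 10; 5];
    [:: 0; 3; 7; 10; 8; 1; 5; 2]; [:: 0; 4; 5; 6; 7; 9; 2; 3];
    [:: 0; 4; 6; 7; 10; 1; 9; 8]; [:: 0; 1; 8; 3; 9; 10; 6; 4; 7];
    [:: 0; 2; 1; 6; 3; 10; 4; 5; 8]; [:: 0; 4; 2; 6; 1; 8; 5; 9; 10];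
    [:: 0; 5; 10; 6; 1; 2; 4; 8; 7]; [:: 0; 3; 5; 2; 7; 6; 10; 4; 1; 9; 8]];
  [::
    [:: 0; 1; 2; 5; 8; 9]; [:: 0; 1; 2; 6; 7; 5]; [:: 0; 1; 3; 5; 8; 9];
    [:: 0; 1; 3; 6; 8; 5]; [:: 0; 2; 3; 4; 5; 10]; [:: 0; 2; 3; 5; 6; 7];
    [:: 0; 2; 3; 5; 7; 1]; [:: 0; 2; 3; 6; 8; 9]; [:: 0; 2; 4; 5; 7; 3];
    [:: 0; 2; 5; 6; 7; 8]; [:: 0; 3; 4; 5; 7; 6]; [:: 0; 3; 4; 6; 7; 1];
    [:: 0; 1; 2; 5; 10; 8; 7]; [:: 0; 1; 2; 6; 4; 9; 7];
    [:: 0; 1; 3; 5; 4; 7; 10]; [:: 0; 1; 3; 6; 7; 2; 8];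
    [:: 0; 1; 4; 5; 2; 6; 9]; [:: 0; 1; 4; 6; 7; 5; 9];
    [:: 0; 2; 3; 5; 1; 6; 7]; [:: 0; 2; 4; 5; 9; 1; 3];
    [:: 0; 2; 5; 7; 9; 4; 3]; [:: 0; 2; 5; 8; 10; 9; 1];
    [:: 0; 3; 4; 5; 10; 8; 7]; [:: 0; 3; 4; 6; 2; 1; 8];
    [:: 0; 3; 4; 7; 9; 1; 5]; [:: 0; 3; 5; 7; 1; 10; 6];
    [:: 0; 4; 5; 6; 9; 2; 3]; [:: 0; 1; 3; 10; 2; 9; 5; 7];
    [:: 0; 1; 4; 3; 6; 9; 7; 5]; [:: 0; 1; 5; 9; 10; 2; 4; 7];
    [:: 0; 2; 3; 4; 7; 8; 1; 9]; [:: 0; 2; 4; 9; 3; 5; 8; 7];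
    [:: 0; 2; 6; 5; 1; 8; 9; 7]; [:: 0; 3; 5; 6; 7; 1; 4; 2];
    [:: 0; 3; 6; 2; 7; 9; 4; 10]; [:: 0; 4; 5; 8; 2; 6; 3; 1];
    [:: 0; 4; 6; 10; 3; 7; 8; 9]; [:: 0; 1; 2; 3; 8; 10; 9; 6; 4];
    [:: 0; 2; 5; 9; 10; 3; 8; 4; 1]; [:: 0; 4; 7; 5; 8; 3; 2; 1; 9];
    [:: 0; 5; 6; 10; 8; 4; 9; 2; 3]; [:: 1; 9; 2; 6; 5; 7; 4; 10; 8; 0; 3]];
  [::
    [:: 0; 1; 2; 3; 4; 7]; [:: 0; 1; 2; 3; 5; 4]; [:: 0; 1; 2; 4; 5; 10];
    [:: 0; 1; 2; 4; 6; 3]; [:: 0; 1; 2; 5; 7; 6]; [:: 0; 1; 2; 6; 7; 10];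
    [:: 0; 1; 3; 6; 7; 4]; [:: 0; 1; 3; 6; 8; 10]; [:: 0; 2; 4; 5; 6; 9];
    [:: 0; 2; 4; 5; 8; 9]; [:: 0; 2; 5; 6; 7; 3]; [:: 0; 3; 4; 5; 6; 7];
    [:: 0; 1; 2; 3; 6; 8; 7]; [:: 0; 1; 2; 5; 6; 10; 9];
    [:: 0; 1; 3; 4; 7; 9; 6]; [:: 0; 1; 3; 7; 2; 9; 8];
    [:: 0; 1; 4; 5; 8; 2; 9]; [:: 0; 1; 4; 6; 9; 5; 2];
    [:: 0; 2; 3; 6; 5; 8; 7]; [:: 0; 2; 4; 6; 8; 1; 9];
    [:: 0; 2; 4; 7; 3; 10; 1]; [:: 0; 2; 5; 6; 9; 8; 10];
    [:: 0; 2; 5; 7; 4; 1; 3]; [:: 0; 3; 4; 5; 1; 10; 7];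
    [:: 0; 3; 4; 7; 5; 2; 6]; [:: 0; 3; 5; 6; 8; 1; 10];
    [:: 0; 3; 6; 7; 8; 1; 9]; [:: 0; 1; 2; 4; 9; 6; 10; 5];
    [:: 0; 1; 4; 7; 5; 3; 6; 10]; [:: 0; 1; 5; 7; 8; 4; 10; 3];
    [:: 0; 1; 6; 10; 7; 3; 4; 2]; [:: 0; 2; 5; 3; 10; 4; 1; 7];
    [:: 0; 2; 6; 1; 9; 3; 7; 10]; [:: 0; 3; 4; 2; 5; 6; 9; 8];
    [:: 0; 3; 5; 1; 7; 2; 8; 10]; [:: 0; 3; 6; 8; 4; 5; 2; 7];
    [:: 0; 3; 7; 2; 9; 5; 4; 8]; [:: 0; 1; 3; 6; 10; 5; 2; 4; 9];
    [:: 0; 3; 2; 9; 8; 4; 10; 5; 7]; [:: 0; 4; 6; 3; 7; 2; 9; 5; 10];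
    [:: 0; 5; 4; 10; 8; 1; 6; 3; 2]; [:: 3; 5; 1; 9; 0; 6; 2; 8; 10; 7; 4]];
  [::
    [:: 0; 1; 2; 4; 6; 7]; [:: 0; 1; 2; 4; 7; 10]; [:: 0; 1; 2; 5; 6; 9];
    [:: 0; 1; 2; 5; 7; 3]; [:: 0; 1; 3; 5; 6; 8]; [:: 0; 1; 3; 6; 7; 5];
    [:: 0; 1; 4; 5; 6; 7]; [:: 0; 1; 4; 5; 7; 2]; [:: 0; 1; 4; 5; 8; 9];
    [:: 0; 2; 3; 4; 7; 6]; [:: 0; 2; 3; 6; 8; 1]; [:: 0; 2; 4; 6; 7; 5];
    [:: 0; 1; 2; 3; 7; 10; 9]; [:: 0; 1; 2; 4; 8; 7; 6];
    [:: 0; 1; 2; 6; 8; 4; 3]; [:: 0; 1; 3; 4; 2; 9; 6];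
    [:: 0; 1; 3; 5; 2; 9; 10]; [:: 0; 1; 4; 6; 8; 10; 2];
    [:: 0; 1; 5; 6; 10; 7; 4]; [:: 0; 1; 5; 7; 3; 4; 8];
    [:: 0; 2; 3; 4; 10; 8; 9]; [:: 0; 2; 3; 5; 8; 10; 7];
    [:: 0; 2; 4; 5; 1; 8; 6]; [:: 0; 2; 5; 6; 8; 1; 10];
    [:: 0; 2; 5; 8; 4; 3; 7]; [:: 0; 3; 4; 6; 5; 1; 9];
    [:: 0; 3; 5; 6; 2; 1; 8]; [:: 0; 1; 2; 7; 9; 8; 3; 6];
    [:: 0; 1; 3; 7; 9; 4; 8; 2]; [:: 0; 1; 4; 8; 3; 5; 6; 7];
    [:: 0; 1; 6; 3; 4; 7; 5; 9]; [:: 0; 2; 3; 7; 8; 5; 9; 4];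
    [:: 0; 2; 5; 1; 8; 7; 3; 9]; [:: 0; 2; 6; 3; 1; 4; 5; 10];
    [:: 0; 3; 4; 5; 2; 1; 8; 6]; [:: 0; 3; 5; 9; 1; 8; 4; 6];
    [:: 0; 4; 6; 2; 3; 9; 5; 1]; [:: 0; 1; 7; 8; 5; 6; 9; 2; 4];
    [:: 0; 2; 4; 7; 10; 6; 9; 8; 5]; [:: 0; 3; 8; 7; 10; 9; 4; 1; 2];
    [:: 0; 5; 1; 8; 10; 3; 4; 7; 2]; [:: 2; 6; 10; 4; 8; 0; 7; 5; 1; 3; 9]];
  [::
    [:: 0; 1; 2; 3; 6; 7]; [:: 0; 1; 2; 4; 6; 5]; [:: 0; 1; 2; 5; 8; 4];
    [:: 0; 1; 3; 4; 5; 2]; [:: 0; 1; 3; 6; 8; 2]; [:: 0; 1; 4; 5; 6; 10];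
    [:: 0; 1; 4; 5; 7; 10]; [:: 0; 1; 4; 6; 7; 3]; [:: 0; 2; 3; 6; 8; 10];
    [:: 0; 2; 4; 6; 7; 1]; [:: 0; 3; 4; 5; 7; 9]; [:: 0; 3; 5; 6; 7; 2];
    [:: 0; 1; 2; 3; 10; 5; 6]; [:: 0; 1; 2; 5; 4; 7; 8];
    [:: 0; 1; 2; 6; 10; 7; 9]; [:: 0; 1; 3; 5; 9; 7; 6];
    [:: 0; 1; 3; 6; 5; 4; 10]; [:: 0; 1; 4; 5; 10; 2; 3];
    [:: 0; 1; 4; 7; 8; 10; 5]; [:: 0; 1; 5; 7; 6; 3; 10];
    [:: 0; 2; 3; 4; 6; 10; 1]; [:: 0; 2; 3; 5; 9; 8; 4];
    [:: 0; 2; 3; 7; 10; 1; 5]; [:: 0; 2; 4; 6; 9; 5; 1];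
    [:: 0; 3; 4; 7; 2; 5; 10]; [:: 0; 3; 5; 7; 8; 2; 6];
    [:: 0; 3; 6; 7; 2; 4; 10]; [:: 0; 1; 2; 8; 6; 10; 4; 3];
    [:: 0; 1; 3; 8; 5; 10; 7; 4]; [:: 0; 1; 5; 6; 8; 4; 2; 3];
    [:: 0; 1; 6; 4; 3; 8; 9; 5]; [:: 0; 2; 3; 10; 8; 1; 4; 5];
    [:: 0; 2; 4; 1; 10; 6; 5; 3]; [:: 0; 2; 6; 10; 4; 7; 1; 5];
    [:: 0; 3; 5; 8; 6; 9; 7; 2]; [:: 0; 3; 7; 9; 4; 10; 1; 5];
    [:: 0; 4; 5; 2; 3; 8; 1; 7]; [:: 0; 1; 4; 9; 8; 5; 10; 7; 2];
    [:: 0; 3; 9; 5; 10; 6; 4; 7; 1]; [:: 0; 4; 3; 9; 2; 6; 7; 8; 10];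
    [:: 0; 5; 8; 10; 9; 2; 3; 7; 1]; [:: 6; 4; 0; 5; 8; 7; 2; 1; 3; 9; 10]]].

Lemma edge_disjoint_SCDs_10 : edge_disjoint_SCDs 5 10.
Proof.
(* The two blocks of five points are invariant under rotation, so they can
   only be singleton chains. *)
pose blocks := [:: [:: 0; 1; 2; 3; 4]; [:: 5; 6; 7; 8; 9]].
apply: (@check_SCDsP 10 (map (rotation_SCD 10 5 blocks) words10)).
by vm_compute.
Qed.

Lemma edge_disjoint_SCDs_11 : edge_disjoint_SCDs 5 11.
Proof.
(* No fixed chains occur: a rotation of order 11 fixes only the empty and the full set, and these
   lie on the chain of the word of length 11. *)
apply: (@check_SCDsP 11 (map (rotation_SCD 11 11 [::]) words11)).
by vm_compute.
Qed.

(** * From bit vectors to sets *)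

Definition set_of_bits (n : nat) (b : bitseq) : cube n :=
  [set i : 'I_n | nth false b i].

Lemma set_of_bits_surj n (x : cube n) :
  exists2 b, size b = n & set_of_bits n b = x.
Proof.
exists [seq i \in x | i <- enum 'I_n]; first by rewrite size_map size_enum_ord.
apply/setP => i; rewrite inE (nth_map i) ?size_enum_ord //.
by rewrite nth_ord_enum.
Qed.

Lemma set_of_bits_inj n :
  {in [pred b | size b == n] &, injective (set_of_bits n)}.
Proof.
move=> b c /eqP sz_b /eqP sz_c /setP eq_bc.
apply: (@eq_from_nth _ false) => [|i lt_i]; first by rewrite sz_b.
by rewrite sz_b in lt_i; have := eq_bc (Ordinal lt_i); rewrite !inE.
Qed.

Lemma card_set_of_bits n b : size b = n -> #|set_of_bits n b| = weight b.
Proof.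
move=> sz_b; rewrite cardsE -sum1_card /weight -sum1_count (big_nth false) sz_b.
by rewrite big_mkord.
Qed.

Lemma sub_set_of_bits n b c : size b = n -> size c = n ->
  (set_of_bits n b \subset set_of_bits n c) = all2 implb b c.
Proof.
move=> sz_b sz_c; apply/subsetP/(all2_nthP _ false) => [|sub i|sub i].
- by rewrite sz_b.
- by rewrite sz_b => lt_i; have := sub (Ordinal lt_i); rewrite !inE => /implyP.
by rewrite !inE; apply/implyP/sub; rewrite sz_b.
Qed.

Lemma is_edge_set_of_bits n b c : size b = n -> size c = n ->
  is_edge (set_of_bits n b) (set_of_bits n c) -> covers b c.
Proof.
move=> sz_b sz_c [sub wE]; rewrite /covers -(sub_set_of_bits sz_b sz_c) sub.
by rewrite -(card_set_of_bits sz_b) -(card_set_of_bits sz_c) wE eqxx.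
Qed.

(** * The number of chains in a partition into symmetric chains *)

Section SCDCard.

Variables (n : nat) (D : {set {set cube n}}).
Hypotheses (partD : partition D [set: cube n])
  (chainD : forall C, C \in D ->
     [/\ is_chain C, is_symmetric C & is_saturated C]).

(* Every symmetric chain contains exactly one set of size [n./2]. *)
Lemma card_symmetric_chain_partition : #|D| = 'C(n, n./2).
Proof.
have /and3P[/eqP coverD trivD _] := partD.
have inD x : x \in cover D by rewrite coverD inE.
rewrite -[n in 'C(n, _)]card_ord -card_draws.
(* [pblock D] matches the sets of size [n./2] with the chains. It is injective on them because
   comparable sets of equal size coincide; its image is all of [D] by saturation. *)
rewrite -(card_in_imset (f := pblock D)) => [|x y]; last first.
  rewrite !inE => /eqP sz_x /eqP sz_y eq_xy.
  have [ch _ _] := chainD (pblock_mem (inD x)).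
  have xC : x \in pblock D x by rewrite mem_pblock.
  have yC : y \in pblock D x by rewrite eq_xy mem_pblock.
  have /orP[sub|sub] := ch _ _ xC yC.
    by apply/eqP; rewrite eqEcard sub sz_x sz_y leqnn.
  by apply/esym/eqP; rewrite eqEcard sub sz_x sz_y leqnn.
congr #|pred_of_set _|; apply/setP => C; apply/idP/imsetP => [DC|[x _ ->]].
  have [_ [k [x [y [minx maxy sz_x sz_y]]]] sat] := chainD DC.
  have le_kn : k <= n by rewrite -sz_x -[leqRHS]card_ord max_card.
  have le_xy : #|x| <= #|y|.
    by rewrite subset_leq_card //; case: minx => _ -> //; case: maxy.
  (* The minimum is contained in the maximum, so [k <= n - k], and [n./2] lies between these two
     sizes. *)
  have le_k : k <= n./2.
    by rewrite geq_half_double -addnn -leq_subRL // -sz_y -sz_x.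
  have [|z Cz sz_z] := sat _ _ minx maxy n./2.
    rewrite sz_x sz_y le_k leq_subRL //.
    by rewrite (leq_trans (leq_add le_k (leqnn _))) // addnn -geq_half_double.
  exists z; first by rewrite inE sz_z.
  by rewrite (def_pblock trivD DC Cz).
exact: pblock_mem.
Qed.

End SCDCard.

(** * Chains of sets from chains of bit vectors *)

Lemma all2_implb_trans : transitive (all2 implb).
Proof.
elim=> [|c y IHy] [|b x] [|d z] //= /andP[bc xy] /andP[cd yz].
by rewrite (IHy _ _ xy yz) andbT; case: (b) (c) (d) bc cd => [] [] [].
Qed.

Lemma weight_nth b C i : path covers b C -> i <= size C ->
  weight (nth [::] (b :: C) i) = weight b + i.
Proof.
elim: C b i => [|c C IHC] b [|i] //= ; rewrite ?addn0 // => /andP[cov chC] lt_i.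
by rewrite -/(nth [::] (c :: C) i) IHC // (covers_weight cov) addnS.
Qed.

(** Along a path of covers the weight grows by one at each step, so the set of size [m] sits at
    position [m - weight b]; comparability follows from transitivity. *)
Lemma sym_chain_set n C S : S = [set:: map (set_of_bits n) C] ->
    sym_chain n C -> {in C, forall b, size b = n} ->
  [/\ is_chain S, is_symmetric S & is_saturated S].
Proof.
move=> defS; case: C defS => [|b C] //= defS /andP[chC /eqP wC] szC.
pose f i := nth [::] (b :: C) i.
have fC i : i <= size C -> f i \in b :: C by move=> le_i; apply: mem_nth.
have cardf i : i <= size C -> #|set_of_bits n (f i)| = weight b + i.
  by move=> le_i; rewrite card_set_of_bits ?weight_nth ?szC ?fC.
have subf i j : i <= j -> j <= size C ->
    set_of_bits n (f i) \subset set_of_bits n (f j).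
  move=> le_ij le_j; have le_i := leq_trans le_ij le_j.
  rewrite sub_set_of_bits ?szC ?fC //.
  apply: (sorted_leq_nth all2_implb_trans all2_implb_refl) => //.
  by apply: sub_path chC => x y /andP[].
have memS i : i <= size C -> set_of_bits n (f i) \in S.
  by move=> /fC fi; rewrite defS inE -map_cons map_f.
have SP x : x \in S -> exists2 i, i <= size C & x = set_of_bits n (f i).
  rewrite defS inE -map_cons => /mapP[c /(nthP [::])[i lt_i <-] ->].
  by exists i.
split.
- move=> _ _ /SP[i le_i ->] /SP[j le_j ->].
  by case/orP: (leq_total i j) => le; apply/orP; [left | right]; apply: subf.
- exists (weight b), (set_of_bits n (f 0)), (set_of_bits n (f (size C))).
  split; rewrite ?cardf ?addn0 //.
  + by split; [exact: memS | move=> _ /SP[i le_i ->]; apply: subf].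
  + by split; [exact: memS | move=> _ /SP[i le_i ->]; apply: subf].
  by rewrite -wC addKn (last_nth [::]) weight_nth.
move=> _ _ [/SP[i le_i ->] _] [/SP[j le_j ->] _] m.
rewrite !cardf // => /andP[le_m le_m'].
have le_b : weight b <= m := leq_trans (leq_addr _ _) le_m.
have le_k : m - weight b <= size C.
  by rewrite leq_subLR (leq_trans le_m') // leq_add2l.
by exists (set_of_bits n (f (m - weight b))); rewrite ?memS // cardf // subnKC.
Qed.

Definition SCD_of_bits (n : nat) (D : seq (seq bitseq)) : {set {set cube n}} :=
  [set:: [seq [set:: map (set_of_bits n) C] | C <- D]].

Lemma mem_SCD_of_bits n D S : S \in SCD_of_bits n D ->
  exists2 C, C \in D & S = [set:: map (set_of_bits n) C].
Proof. by rewrite inE => /mapP. Qed.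

(** Turns the absence of repetitions in the concatenated list into disjointness of the blocks. *)
Lemma uniq_flatten_inj (T : eqType) (ss : seq (seq T)) s t x :
  uniq (flatten ss) -> s \in ss -> t \in ss -> x \in s -> x \in t -> s = t.
Proof.
elim: ss => //= u ss IHss; rewrite cat_uniq => /and3P[_ /hasPn dis uniq_ss].
have disj v : v \in ss -> x \in u -> x \in v -> False.
  move=> ss_v xu xv; suff /dis/negP : x \in flatten ss by [].
  by apply/flattenP; exists v.
rewrite !inE => /predU1P[->|ss_s] /predU1P[->|ss_t] // xs xt.
- by case: (disj _ ss_t xs xt).
- by case: (disj _ ss_s xt xs).
exact: IHss.
Qed.

Lemma SCD_of_bitsP n D : bit_SCD n D -> is_SCD (SCD_of_bits n D).
Proof.
move=> scdD; have [chD uniqD memD] := scdD.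
have chain S : S \in SCD_of_bits n D ->
    [/\ is_chain S, is_symmetric S & is_saturated S].
  case/mem_SCD_of_bits => C DC defS; apply: (sym_chain_set defS).
    exact: (allP chD).
  by move=> b; apply: bit_SCD_size DC.
(* The required number of chains follows from the partition property. *)
suff partD : partition (SCD_of_bits n D) [set: cube n].
  by split=> //; apply: card_symmetric_chain_partition.
apply/and3P; split.
- apply/eqP/setP => x; rewrite inE; have [b sz_b <-] := set_of_bits_surj x.
  have /flattenP[C DC Cb] : b \in flatten D by rewrite memD inE sz_b.
  by apply/bigcupP; exists [set:: map (set_of_bits n) C]; rewrite inE map_f.
- apply/trivIsetP => _ _ /mem_SCD_of_bits[C DC ->] /mem_SCD_of_bits[E DE ->].
  apply: contraNT => /pred0Pn[x /andP[]].
  rewrite !inE => /mapP[b Cb ->] /mapP[c Ec eq_bc].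
  have sz_b := bit_SCD_size scdD DC Cb; have sz_c := bit_SCD_size scdD DE Ec.
  have eqbc : b = c by apply: set_of_bits_inj eq_bc; rewrite inE ?sz_b ?sz_c.
  by rewrite (uniq_flatten_inj uniqD DC DE Cb) // eqbc.
(* The empty set is no block, because [sym_chain] rejects the empty list. *)
apply/negP => /mem_SCD_of_bits[C /(allP chD)].
by case: C => [|b C] //= _ /setP/(_ (set_of_bits n b)); rewrite !inE eqxx.
Qed.

(** Vectors of length [n] are determined by their sets, so a common edge of sets comes from a common
    edge of vectors. *)
Lemma edge_disjoint_of_bits n D1 D2 : bit_SCD n D1 -> bit_SCD n D2 ->
  bit_edge_disjoint D1 D2 ->
  edge_disjoint (SCD_of_bits n D1) (SCD_of_bits n D2).
Proof.
move=> S1 S2 dis x y S T /mem_SCD_of_bits[C DC ->] /mem_SCD_of_bits[E DE ->].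
move=> [[edge]]; rewrite !inE => /mapP[b Cb Dx] /mapP[c Cc Dy] [_].
rewrite !inE => /mapP[b' Eb' Dx'] /mapP[c' Ec' Dy'].
have sz_b := bit_SCD_size S1 DC Cb; have sz_c := bit_SCD_size S1 DC Cc.
have sz_b' := bit_SCD_size S2 DE Eb'; have sz_c' := bit_SCD_size S2 DE Ec'.
have eqb : b = b'.
  by apply: (@set_of_bits_inj n); rewrite ?inE ?sz_b ?sz_b' // -Dx.
have eqc : c = c'.
  by apply: (@set_of_bits_inj n); rewrite ?inE ?sz_c ?sz_c' // -Dy.
rewrite Dx Dy in edge; have cov := is_edge_set_of_bits sz_b sz_c edge.
by apply: dis DC DE cov _; rewrite {2}eqb {2}eqc.
Qed.

Theorem theorem2 (n : nat) (hn : 90 <= n) :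
  exists D : 'I_5 -> {set {set cube n}},
    (forall i : 'I_5, is_SCD (D i)) /\
    (forall i j : 'I_5, i != j -> edge_disjoint (D i) (D j)).
Proof.
suff [D scdD dis] : edge_disjoint_SCDs 5 n.
  exists (fun i => SCD_of_bits n (D i)); split=> [i|i j nij].
    exact: SCD_of_bitsP.
  exact: edge_disjoint_of_bits (dis i j nij).
(* Write [n = 10 * q + r] with [r <= 9]. Since [n >= 90] gives [q >= 9], the difference [q - r] is
   not truncated, and [n = 10 * (q - r) + 11 * r]. *)
have le_mod : n %% 10 <= n %/ 10.
  by apply: (@leq_trans 9); [rewrite -ltnS ltn_mod | rewrite leq_divRL].
have -> : n = (n %/ 10 - n %% 10) * 10 + n %% 10 * 11.
  by rewrite (mulnDr _ 10 1) muln1 addnA -mulnDl subnK // -divn_eq.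
apply: edge_disjoint_SCDs_add; apply: edge_disjoint_SCDs_muln.
  exact: edge_disjoint_SCDs_10.
exact: edge_disjoint_SCDs_11.
Qed.
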